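(* Let $A\in\mathbb{R}^{n\times n}$. Then $A$ is stable if and only if there exist $S,U,B\in\mathbb{R}^{n\times n}$ such that $S$ is invertible, $U^TU=I_n$, $B$ is symmetric positive semidefinite, $\|B\|\le 1$, and $A=S^{-1}UBS$.
   Context: A real square matrix is called stable if all its eigenvalues lie in the closed unit disk $\{z\in\mathbb{C}:|z|\le 1\}$ and those eigenvalues on the unit circle are semisimple (algebraic multiplicity equals geometric multiplicity). $\|\cdot\|$ denotes the spectral norm and $I_n$ the $n\times n$ identity matrix. *)

(* Defs.v *)
(* Real numbers are modelled as the real elements of an
   arbitrary numeric closed field C (e.g. algC, or complexes); a real matrix
   is a matrix over C all of whose entries are real. *)
From HB Require Import structures.
From mathcomp Require Import all_boot all_order all_algebra.
Set Implicit Arguments. Unset Strict Implicit. Unset Printing Implicit Defensive.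
Import Order.TTheory GRing.Theory Num.Theory.
Local Open Scope ring_scope.

Definition real_mx (C : numClosedFieldType) (m n : nat) (A : 'M[C]_(m, n)) : Prop :=
  forall i j, A i j \is Num.real.

Definition alg_mult (C : numClosedFieldType) (n : nat) (A : 'M[C]_n) (a : C) : nat :=
  mup a (char_poly A).

Definition geo_mult (C : numClosedFieldType) (n : nat) (A : 'M[C]_n) (a : C) : nat :=
  \rank (eigenspace A a).

Definition stable (C : numClosedFieldType) (n : nat) (A : 'M[C]_n) : Prop :=
  forall a : C, eigenvalue A a ->
    `|a| <= 1 /\ (`|a| = 1 -> alg_mult A a = geo_mult A a).

Definition sym_psd (C : numClosedFieldType) (n : nat) (B : 'M[C]_n) : Prop :=
  B^T = B /\
  forall x : 'cV[C]_n, real_mx x -> 0 <= (x^T *m B *m x) 0 0.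

(* spectral norm ||B|| <= 1, i.e. sup_{x <> 0} ||Bx||_2 / ||x||_2 <= 1,
   written as ||Bx||_2^2 <= ||x||_2^2 for all real vectors x. *)
Definition spec_norm_le1 (C : numClosedFieldType) (n : nat) (B : 'M[C]_n) : Prop :=
  forall x : 'cV[C]_n, real_mx x ->
    ((B *m x)^T *m (B *m x)) 0 0 <= (x^T *m x) 0 0.

(* Main.v *)
(* If N = U B with ||B|| <= 1, then |x N| <= |x| for all row vectors x, so N has
   its spectrum in the closed disk and is semisimple on the unit circle; both
   properties pass to A by similarity.

   Conversely, a stable A contracts some Hermitian norm |xR|: split off the
   unimodular eigenvalues, which semisimplicity allows, and on the rest deflate
   one eigenvalue at a time, rescaling to make the off-diagonal part small.  On
   real vectors |xR|^2 is a real positive definite form, and its Cholesky factor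
   G makes N = G^-1 A G a real contraction.  The polar decomposition N = U B
   concludes.  The field need not be archimedean, so limits and norms of powers
   are avoided throughout. *)
Require Import Defs.
From HB Require Import structures.
From mathcomp Require Import all_boot all_order all_algebra.
From mathcomp Require Import ring.
Set Implicit Arguments. Unset Strict Implicit. Unset Printing Implicit Defensive.
Import Order.TTheory GRing.Theory Num.Theory.
Local Open Scope ring_scope.

(** * Algebraic and geometric multiplicity *)

Section Multiplicities.
Variable C : numClosedFieldType.

(** No Jordan block at [a] exceeds size one. In this form the property restricts to diagonal blocks
    and can be tested on contractions without counting dimensions; [semisimple_atP] ties it to the
    multiplicities. *)
Definition semisimple_at n (A : 'M[C]_n) (a : C) : Prop :=
  forall w : 'rV[C]_n, w *m (A - a%:M) *m (A - a%:M) = 0 -> w *m (A - a%:M) = 0.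

Lemma char_poly_similar n (S A B : 'M[C]_n) :
  S \in unitmx -> S *m A = B *m S -> char_poly A = char_poly B.
Proof.
move=> uS e; have nz : \det (map_mx polyC S) != 0.
  by rewrite det_map_mx polyC_eq0 -unitfE -unitmxE.
apply: (mulfI nz); rewrite [RHS]mulrC /char_poly -!det_mulmx; congr (\det _).
by rewrite /char_poly_mx mulmxBr mulmxBl scalar_mxC -!map_mxM e.
Qed.

Lemma sub_scalar_similar n (S A B : 'M[C]_n) a :
  S *m A = B *m S -> S *m (A - a%:M) = (B - a%:M) *m S.
Proof. by move=> e; rewrite mulmxBr mulmxBl e scalar_mxC. Qed.

Lemma similar_sym n (S A B : 'M[C]_n) :
  S \in unitmx -> S *m A = B *m S -> invmx S *m B = A *m invmx S.
Proof.
by move=> uS e; apply: (canRL (mulmxK uS)); rewrite -mulmxA -e mulKmx.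
Qed.

Lemma semisimple_similar n (S A B : 'M[C]_n) a :
  S \in unitmx -> S *m A = B *m S -> semisimple_at A a -> semisimple_at B a.
Proof.
move=> uS /(@sub_scalar_similar _ _ _ _ a) e ssA w w0.
apply: (can_inj (mulmxK uS)); rewrite mul0mx -mulmxA -e mulmxA.
apply: ssA; rewrite -(mulmxA w) e mulmxA -[_ *m S *m _]mulmxA e mulmxA w0.
by rewrite mul0mx.
Qed.

Lemma geo_mult_similar n (S A B : 'M[C]_n) a :
  S \in unitmx -> S *m A = B *m S -> geo_mult A a = geo_mult B a.
Proof.
move=> uS /(@sub_scalar_similar _ _ _ _ a) e.
rewrite /geo_mult /eigenspace !mxrank_ker.
have <- : \rank (S *m (A - a%:M)) = \rank (A - a%:M).
  by rewrite (eqmxMfull _ _) // row_full_unit.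
by rewrite e mxrankMfree // row_free_unit.
Qed.

Lemma scale_usubmx1 m (a : C) :
  a *: usubmx (1%:M : 'M[C]_(1 + m)) = row_mx a%:M 0.
Proof.
rewrite (scalar_mx_block 1 m 1) /block_mx col_mxKu scale_row_mx scaler0.
by rewrite scale_scalar_mx mulr1.
Qed.

(** A left eigenvector, up to a scalar, is completed to a basis as the first row of [S]; in that
    basis the first row of [A] is [(a, 0)]. *)
Lemma deflate m (A : 'M[C]_(1 + m)) (a : C) : eigenvalue A a ->
  exists S c (A' : 'M[C]_m),
    S \in unitmx /\ S *m A = block_mx a%:M 0 c A' *m S.
Proof.
case/eigenvalueP=> v vA v0.
pose S : 'M[C]_(1 + m) := row_ebase v.
have uS : S \in unitmx by exact: row_ebase_unit.
(* Since [v] has rank one, Gaussian elimination exhibits it as a scalar multiple of the first row of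
   the invertible [S]. *)
have vE : v = (col_ebase v) 0 0 *: usubmx S.
  have := mulmx_ebase v; rewrite rank_rV v0 => {1}<-.
  rewrite {1}[col_ebase v]mx11_scalar -mulmxA mul_scalar_mx; congr (_ *: _).
  rewrite -/S -{1}[S]vsubmxK [pid_mx _](pid_mx_row _ m 1) mul_row_col.
  by rewrite mul1mx mul0mx addr0.
have k0 : (col_ebase v) 0 0 != 0.
  by apply: contraNneq v0 => k0; rewrite vE k0 scale0r.
have SA : usubmx S *m A = a *: usubmx S.
  apply: (scalerI k0); rewrite scalemxAl -vE vA {1}vE.
  by rewrite !scalerA mulrC.
pose M := S *m A *m invmx S.
exists S, (dlsubmx M), (drsubmx M); split=> //.
suff -> : block_mx a%:M 0 (dlsubmx M) (drsubmx M) = M by rewrite /M mulmxKV.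
have uM : usubmx M = row_mx a%:M 0.
  rewrite /M -!mul_usub_mx SA -scalemxAl mul_usub_mx mulmxV //.
  exact: scale_usubmx1.
by rewrite /block_mx hsubmxK -uM vsubmxK.
Qed.

Lemma char_poly_deflated m (a : C) c (A' : 'M[C]_m) :
  char_poly (block_mx a%:M 0 c A' : 'M_(1 + m)) = ('X - a%:P) * char_poly A'.
Proof.
rewrite /char_poly /char_poly_mx map_block_mx map_scalar_mx !map_mx0.
by rewrite (scalar_mx_block 1 m) opp_block_mx add_block_mx oppr0 addr0 det_lblock
           -raddfB /= det_scalar1.
Qed.

Lemma alg_mult_deflated m (a b : C) c (A' : 'M[C]_m) :
  alg_mult (block_mx a%:M 0 c A' : 'M_(1 + m)) b = ((a == b) + alg_mult A' b)%N.
Proof.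
rewrite /alg_mult char_poly_deflated mupM ?polyXsubC_eq0 //;
  last by rewrite monic_neq0 ?char_poly_monic.
by rewrite (@mup_XsubCX _ 1); case: eqP.
Qed.

Lemma deflated_sub_scalar m (a b : C) c (A' : 'M[C]_m) :
  (block_mx a%:M 0 c A' : 'M_(1 + m)) - b%:M = block_mx (a - b)%:M 0 c (A' - b%:M).
Proof.
by rewrite (scalar_mx_block 1 m) opp_block_mx add_block_mx !oppr0 !addr0 -raddfB.
Qed.

(** Subtracting [a] kills the first row, so the first coordinate is free in the left kernel and
    accounts for the successor. *)
Lemma geo_mult_deflated m (a : C) c (A' : 'M[C]_m) :
  geo_mult (block_mx a%:M 0 c A' : 'M_(1 + m)) a
    = (\rank (kermx (row_mx c (A' - a%:M)))).+1.
Proof.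
rewrite /geo_mult /eigenspace deflated_sub_scalar subrr !mxrank_ker.
by rewrite raddf0 /block_mx row_mx0 rank_col_0mx subSn ?rank_leq_row.
Qed.

Lemma kermx_row_mx_sub m p q (c : 'M[C]_(m, p)) (M : 'M[C]_(m, q)) :
  (kermx (row_mx c M) <= kermx M)%MS.
Proof.
apply/sub_kermxP; have := mulmx_ker (row_mx c M); rewrite mul_mx_row.
by rewrite -row_mx0 => /eq_row_mx[].
Qed.

(** Deflating at [a] takes exactly one off the algebraic multiplicity and at most one off the
    geometric one. *)
Lemma geo_mult_le_alg_mult n (A : 'M[C]_n) a : (geo_mult A a <= alg_mult A a)%N.
Proof.
elim: n A => [|m IH] A; first by rewrite /geo_mult thinmx0 mxrank0.
have [/deflate[S [c [A' [uS e]]]]|nA] := boolP (eigenvalue A a); last first.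
  by rewrite /geo_mult; move: nA; rewrite negbK => /eqP ->; rewrite mxrank0.
rewrite (geo_mult_similar _ uS e) /alg_mult (char_poly_similar uS e).
rewrite -/(alg_mult _ _) alg_mult_deflated geo_mult_deflated eqxx ltnS.
by rewrite (leq_trans _ (IH A')) // mxrankS ?kermx_row_mx_sub.
Qed.

(** After deflation at [a], both sides amount to the same two conditions: [A'] is semisimple at [a],
    and the left kernel of [A' - a] annihilates [c]. *)
Lemma semisimple_atP n (A : 'M[C]_n) a :
  alg_mult A a = geo_mult A a <-> semisimple_at A a.
Proof.
elim: n A => [|m IH] A.
  split=> [_ w _|_]; first by rewrite [LHS]thinmx0.
  rewrite /geo_mult [eigenspace _ _]thinmx0 mxrank0 /alg_mult mupNroot //.
  by rewrite /char_poly det_mx00 rootC oner_eq0.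
have [eA|nA] := boolP (eigenvalue A a); last first.
  have k0 : eigenspace A a = 0 by move: nA; rewrite negbK => /eqP.
  rewrite /geo_mult k0 mxrank0 /alg_mult mupNroot -?eigenvalue_root_char //.
  split=> // _ w /eqP; rewrite mulmx_free_eq0 => [/eqP //|].
  by rewrite -kermx_eq0 -/(eigenspace A a) k0.
have [S [c [A' [uS e]]]] := deflate eA.
rewrite (geo_mult_similar _ uS e) /alg_mult (char_poly_similar uS e).
rewrite -/(alg_mult _ _) alg_mult_deflated geo_mult_deflated eqxx.
rewrite (add1n (alg_mult A' a)).
suff ss : (alg_mult A' a).+1 = (\rank (kermx (row_mx c (A' - a%:M)))).+1
          <-> semisimple_at (block_mx a%:M 0 c A') a.
  apply: iff_trans ss _.
  split; last exact: semisimple_similar uS e.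
  by apply: semisimple_similar (similar_sym uS e); rewrite unitmx_inv.
have mulE (x1 : 'rV_1) (x2 : 'rV_m) :
    row_mx x1 x2 *m (block_mx a%:M 0 c A' - a%:M)
      = row_mx (x2 *m c) (x2 *m (A' - a%:M)).
  by rewrite deflated_sub_scalar subrr raddf0 mul_row_block !mulmx0 !add0r.
have leK := mxrankS (kermx_row_mx_sub c (A' - a%:M)).
split=> [[alg_eq] w | ssA].
  (* The algebraic multiplicity equals the dimension of the joint kernel, which is at most the
     geometric multiplicity, itself at most the algebraic one; hence all three agree. *)
  have geoA : alg_mult A' a = geo_mult A' a.
    by apply/eqP; rewrite eqn_leq geo_mult_le_alg_mult alg_eq leK.
  have ssA' := (IH A').1 geoA.
  rewrite -(hsubmxK w) !mulE -row_mx0 => /eq_row_mx[_ /ssA' x2M].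
  have leK' : (kermx (A' - a%:M) <= kermx (row_mx c (A' - a%:M)))%MS.
    rewrite -(geq_leqif (mxrank_leqif_sup (kermx_row_mx_sub _ _))).
    by rewrite -alg_eq geoA.
  have x2K : (rsubmx w <= kermx (A' - a%:M))%MS by apply/sub_kermxP.
  have /sub_kermxP := submx_trans x2K leK'.
  by rewrite mul_mx_row x2M -row_mx0 => /eq_row_mx[-> _].
(* For [x] in the kernel, [(0, x)] is sent to [(x c, 0)] and then to 0, so semisimplicity forces
   [x c = 0]. *)
have leK' : (kermx (A' - a%:M) <= kermx (row_mx c (A' - a%:M)))%MS.
  apply/row_subP=> i; set x := row i _.
  have xM : x *m (A' - a%:M) = 0 by apply/sub_kermxP; apply: row_sub.
  apply/sub_kermxP; rewrite mul_mx_row.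
  by have := ssA (row_mx 0 x); rewrite !mulE xM !mul0mx row_mx0; apply.
suff -> : alg_mult A' a = geo_mult A' a.
  by congr _.+1; apply/eqP; rewrite eqn_leq leK (mxrankS leK').
(* First [x (A' - a)] lies in the kernel, hence annihilates [c]; then the square kills [(0, x)], and
   semisimplicity applies once more. *)
apply/IH => x xMM.
have := ssA (row_mx 0 (x *m (A' - a%:M))); rewrite !mulE xMM !mul0mx row_mx0.
move=> /(_ erefl); rewrite -[in RHS]row_mx0 => /eq_row_mx[xMc _].
have := ssA (row_mx 0 x); rewrite !mulE xMM xMc row_mx0.
by move=> /(_ erefl); rewrite -[in RHS]row_mx0 => /eq_row_mx[].
Qed.
End Multiplicities.

(** * Contractions *)

Section Contractions.
Variable C : numClosedFieldType.

Definition dot n (x y : 'rV[C]_n) : C := \sum_j x 0 j * (y 0 j)^*.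

Definition sqnorm n (x : 'rV[C]_n) : C := \sum_j `|x 0 j| ^+ 2.

Lemma sqnorm_ge0 n (x : 'rV[C]_n) : 0 <= sqnorm x.
Proof. by apply: sumr_ge0 => j _; rewrite exprn_ge0. Qed.

Lemma sqnorm_eq0 n (x : 'rV[C]_n) : (sqnorm x == 0) = (x == 0).
Proof.
apply/eqP/eqP=> [/eqP|->]; last first.
  by apply: big1 => j _; rewrite mxE normr0 expr0n.
rewrite psumr_eq0 => [/allP x0|j _]; last exact: exprn_ge0.
apply/rowP=> j; rewrite mxE; apply/eqP.
by have := x0 j (mem_index_enum j); rewrite sqrf_eq0 normr_eq0.
Qed.

Lemma sqnorm_gt0 n (x : 'rV[C]_n) : (0 < sqnorm x) = (x != 0).
Proof. by rewrite lt_def sqnorm_ge0 andbT sqnorm_eq0. Qed.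

Lemma sqnormZ n a (x : 'rV[C]_n) : sqnorm (a *: x) = `|a| ^+ 2 * sqnorm x.
Proof.
by rewrite /sqnorm mulr_sumr; apply: eq_bigr => j _; rewrite mxE normrM exprMn.
Qed.

Lemma sqnorm_row_mx m n (x : 'rV[C]_m) (y : 'rV[C]_n) :
  sqnorm (row_mx x y) = sqnorm x + sqnorm y.
Proof.
rewrite /sqnorm big_split_ord /=.
by congr (_ + _); apply: eq_bigr => j _; rewrite ?row_mxEl ?row_mxEr.
Qed.

Lemma sqnorm_row1 (x : 'rV[C]_1) : sqnorm x = `|x 0 0| ^+ 2.
Proof. by rewrite /sqnorm big_ord1. Qed.

Lemma dotDl n (x y z : 'rV[C]_n) : dot (x + y) z = dot x z + dot y z.
Proof. by rewrite /dot -big_split; apply: eq_bigr => j _; rewrite mxE mulrDl. Qed.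

Lemma dotZl n a (x y : 'rV[C]_n) : dot (a *: x) y = a * dot x y.
Proof. by rewrite /dot mulr_sumr; apply: eq_bigr => j _; rewrite mxE mulrA. Qed.

Lemma dot_self n (x : 'rV[C]_n) : dot x x = sqnorm x.
Proof. by apply: eq_bigr => j _; rewrite normCK. Qed.

Lemma sqnormD n (x y : 'rV[C]_n) :
  sqnorm (x + y) = sqnorm x + sqnorm y + (dot x y + (dot x y)^*).
Proof.
rewrite /sqnorm /dot rmorph_sum -!big_split; apply: eq_bigr => j _ /=.
by rewrite mxE !normCK rmorphD rmorphM /= conjCK; ring.
Qed.

Lemma contraction_eigenvalue_le1 n (N : 'M[C]_n) a :
  (forall x : 'rV_n, sqnorm (x *m N) <= sqnorm x) -> eigenvalue N a -> `|a| <= 1.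
Proof.
move=> leN /eigenvalueP[v vN]; rewrite -sqnorm_gt0 => v_gt0.
have := leN v; rewrite vN sqnormZ ger_pMl //.
by rewrite expr_le1.
Qed.

(* Let [v := w (N - a)], so that [v N = a v].  Subtracting from [w] its projection
   on [v] preserves [w N = a w + v], and then |wN|^2 = |w|^2 + |v|^2. *)
Lemma contraction_semisimple n (N : 'M[C]_n) a :
  (forall x : 'rV_n, sqnorm (x *m N) <= sqnorm x) -> `|a| = 1 -> semisimple_at N a.
Proof.
move=> leN a1 w; set v := w *m _ => vNa; apply/eqP; case: eqVneq => // v0.
have vN : v *m N = a *: v.
  by apply/eqP; rewrite -mul_mx_scalar -subr_eq0 -mulmxBr vNa.
have wN : w *m N = a *: w + v by rewrite /v mulmxBr mul_mx_scalar addrC subrK.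
pose w0 := w - (dot w v / sqnorm v) *: v.
have w0N : w0 *m N = a *: w0 + v.
  by rewrite mulmxBl wN -scalemxAl vN scalerBr !scalerA [a * _]mulrC addrAC.
have w0v : dot w0 v = 0.
  by rewrite dotDl -scaleNr dotZl dot_self mulNr divfK ?subrr // sqnorm_eq0.
have := leN w0; rewrite w0N sqnormD dotZl w0v mulr0 conjC0 !addr0 sqnormZ a1.
by rewrite expr1n mul1r gerDl => /le_gtF; rewrite sqnorm_gt0 v0.
Qed.

(** Convexity of the square with weights [|a|] and [1 - |a|], applied to [|x|] and
    [|z| / (1 - |a|)]; the gap is the weighted variance. It bounds the cross term of a deflated
    block. *)
Lemma normr_convexity (a x z : C) : `|a| < 1 ->
  `|a * x + z| ^+ 2 <= `|a| * `|x| ^+ 2 + `|z| ^+ 2 / (1 - `|a|).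
Proof.
move=> a1; have s_gt0 : 0 < 1 - `|a| by rewrite subr_gt0.
apply: (@le_trans _ _ ((`|a| * `|x| + `|z|) ^+ 2)).
  by rewrite lerXn2r ?nnegrE ?addr_ge0 ?mulr_ge0 // -normrM ler_normD.
rewrite -subr_ge0.
have -> : `|a| * `|x| ^+ 2 + `|z| ^+ 2 / (1 - `|a|) - (`|a| * `|x| + `|z|) ^+ 2
  = `|a| / (1 - `|a|) * ((1 - `|a|) * `|x| - `|z|) ^+ 2.
  by field; rewrite gt_eqF.
rewrite mulr_ge0 ?divr_ge0 ?(ltW s_gt0) //.
by rewrite real_exprn_even_ge0 // !(rpredB, rpredM) ?rpred1 ?normr_real.
Qed.

(** A crude constant is enough: the square of the l1 norm of [c], as every [|x_j|] is at most the
    square root of [sqnorm x]. *)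
Lemma sqnorm_mul_col_le n (c : 'cV[C]_n) :
  exists2 K, 0 <= K & forall x : 'rV_n, `|(x *m c) 0 0| ^+ 2 <= K * sqnorm x.
Proof.
exists ((\sum_j `|c j 0|) ^+ 2); first by rewrite exprn_ge0 ?sumr_ge0.
move=> x; rewrite -[sqnorm x]sqrtCK -exprMn lerXn2r ?nnegrE //.
  by rewrite mulr_ge0 ?sumr_ge0 ?sqrtC_ge0 ?sqnorm_ge0.
rewrite mxE (le_trans (ler_norm_sum _ _ _)) // mulr_suml ler_sum // => j _.
rewrite normrM mulrC ler_wpM2l //.
rewrite -[`|x 0 j|]sqrCK // ler_sqrtC ?nnegrE ?exprn_ge0 ?sqnorm_ge0 //.
by rewrite /sqnorm (bigD1 j) //= lerDl sumr_ge0 // => i _; rewrite exprn_ge0.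
Qed.
End Contractions.

(** * Adapted norms *)

Section AdaptedNorm.
Variable C : numClosedFieldType.

Lemma eigenvalue_deflated m (S A : 'M[C]_(1 + m)) a c (A' : 'M[C]_m) b :
  S \in unitmx -> S *m A = block_mx a%:M 0 c A' *m S ->
  eigenvalue A' b -> eigenvalue A b.
Proof.
move=> uS e; rewrite !eigenvalue_root_char (char_poly_similar uS e).
by rewrite char_poly_deflated rootM => ->; rewrite orbT.
Qed.

(* The off-diagonal part of a deflation is absorbed by rescaling the trailing
   coordinates by a large [t]. *)
Lemma strict_adapted_norm n (A : 'M[C]_n) :
  (forall a, eigenvalue A a -> `|a| < 1) ->
  exists R e, [/\ R \in unitmx, 0 < e, e <= 1
    & forall x, sqnorm (x *m A *m R) <= (1 - e) * sqnorm (x *m R)].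
Proof.
elim: n A => [|m IH].
  move=> A _.
  exists 1%:M, 1; split; rewrite ?unitmx1 //.
  by move=> x; rewrite subrr mul0r /sqnorm big_ord0.
rewrite -[m.+1]/(1 + m)%N => A ltA.
have [a eA] := eigenvalue_closed A (ltn0Sn m).
have [S [c [A' [uS e]]]] := deflate eA.
have ltA' b : eigenvalue A' b -> `|b| < 1 by move/(eigenvalue_deflated uS e)/ltA.
have [R' [e' [uR' e'_gt0 e'_le1 leR']]] := IH A' ltA'.
have a1 := ltA a eA.
have [K K_ge0 leK] := sqnorm_mul_col_le (invmx R' *m c).
set s := 1 - `|a|; have s_gt0 : 0 < s by rewrite subr_gt0.
have s_le1 : s <= 1 by rewrite gerBl.
(* Chosen so that [t * (e' / 2) = e' / 2 + K / s]; as [t >= 1], the off-diagonal cost [K / s] then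
   uses at most half of the gap [t ^+ 2 * e']. *)
pose t := 1 + 2 * K / (s * e').
have t_ge1 : 1 <= t.
  by rewrite lerDl divr_ge0 ?mulr_ge0 ?ler0n ?(ltW s_gt0) ?(ltW e'_gt0).
have t_gt0 : 0 < t := lt_le_trans ltr01 t_ge1.
have leKt : K / s <= t ^+ 2 * (e' / 2).
  apply: (@le_trans _ _ (t * (e' / 2))); last first.
    by rewrite ler_wpM2r ?divr_ge0 ?(ltW e'_gt0) // -[leLHS]mulr1 ler_wpM2l // ltW.
  rewrite -subr_ge0; have -> : t * (e' / 2) - K / s = e' / 2.
    by rewrite /t; field; rewrite !gt_eqF.
  by rewrite divr_ge0 ?(ltW e'_gt0).
(* The first coordinate contracts with gap [s], the others keep gap [e' / 2]; both factors are at
   most 1, so their product is below each. *)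
exists (invmx S *m block_mx 1%:M 0 0 (t *: R')), (s * (e' / 2)); split.
- by rewrite unitmx_mul unitmx_inv uS (@block_diag_mx_unit _ 1 m) unitmx1 unitmxZ //
             unitfE gt_eqF.
- by rewrite !mulr_gt0 ?invr_gt0.
- rewrite mulr_ile1 ?(ltW s_gt0) ?divr_ge0 ?(ltW e'_gt0) //.
  by rewrite ler_pdivrMr // (le_trans e'_le1) // mul1r ler1n.
move=> x; rewrite !mulmxA -[x *m A *m _]mulmxA -(similar_sym uS e) mulmxA.
rewrite -(hsubmxK (x *m invmx S)).
move: (lsubmx _) (rsubmx _) => x1 x2.
rewrite !mul_row_block !mulmx0 !addr0 !add0r !mulmx1 !sqnorm_row_mx -!scalemxAr.
rewrite !sqnormZ !sqnorm_row1 (gtr0_norm t_gt0).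
have -> : (x1 *m a%:M + x2 *m c) 0 0 = a * x1 0 0 + (x2 *m c) 0 0.
  by rewrite mul_mx_scalar 2!mxE.
have leX := normr_convexity (x1 0 0) ((x2 *m c) 0 0) a1.
have leZ : `|(x2 *m c) 0 0| ^+ 2 <= K * sqnorm (x2 *m R').
  by have := leK (x2 *m R'); rewrite -mulmxA mulKVmx.
have leW := leR' x2.
have N_ge0 := sqnorm_ge0 (x2 *m R').
have X_ge0 : 0 <= `|x1 0 0| ^+ 2 by rewrite exprn_ge0.
move: leX leZ leW N_ge0 X_ge0; rewrite -/s.
have -> : `|a| = 1 - s by rewrite /s opprB addrC subrK.
move: (_ ^+ 2) (_ ^+ 2) (`|x1 0 0| ^+ 2) (sqnorm _) (sqnorm _).
(* With [x = (x1, x2)] in the deflated basis: [Z] is |x2 c|^2, [F] is |a x1 + x2 c|^2, [X] is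
   |x1|^2, [W] is |x2 A' R'|^2 and [N] is |x2 R'|^2. *)
move=> Z F X W N leF leZ leW N_ge0 X_ge0.
apply: (le_trans (lerD leF (ler_wpM2l (exprn_ge0 _ (ltW t_gt0)) leW))).
have leZs : Z / s <= t ^+ 2 * (e' / 2) * N.
  apply: (@le_trans _ _ (K / s * N)); last by rewrite ler_wpM2r.
  by rewrite mulrAC ler_wpM2r // invr_ge0 ltW.
apply: (le_trans (lerD (lerD (lexx _) leZs) (lexx _))); rewrite -subr_ge0.
have -> : (1 - s * (e' / 2)) * (X + t ^+ 2 * N)
    - ((1 - s) * X + t ^+ 2 * (e' / 2) * N + t ^+ 2 * ((1 - e') * N))
  = X * (s * (1 - e' / 2)) + t ^+ 2 * N * (e' / 2) * (1 - s) by field.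
have e'2_le1 : e' / 2 <= 1.
  by rewrite ler_pdivrMr // (le_trans e'_le1) // mul1r ler1n.
by rewrite addr_ge0 // !mulr_ge0 ?exprn_ge0 ?subr_ge0 ?invr_ge0 // ltW.
Qed.

(** Duality: if the left kernel of [M] annihilates [c], the columns of [c] lie in the column space
    of [M]. The rows of [1 - M *m pinvmx M] lie in that left kernel. *)
Lemma solve_mul_col m p (M : 'M[C]_m) (c : 'M[C]_(m, p)) :
  (forall x : 'rV_m, x *m M = 0 -> x *m c = 0) -> exists y, c = M *m y.
Proof.
move=> kerMc; exists (pinvmx M *m c); rewrite mulmxA.
apply/eqP; rewrite -subr_eq0 -{1}[c]mul1mx -mulmxBl; apply/eqP/row_matrixP=> i.
rewrite row0 row_mul kerMc // -row_mul mulmxBl mulmxKpV // mul1mx subrr row0 //.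
Qed.

(** A unimodular eigenvalue splits off exactly: semisimplicity makes the off-diagonal column
    removable, and multiplication by [a] preserves the modulus of its coordinate. Once none is left,
    [strict_adapted_norm] applies. *)
Theorem adapted_norm n (A : 'M[C]_n) :
  (forall a, eigenvalue A a -> `|a| <= 1 /\ (`|a| = 1 -> semisimple_at A a)) ->
  exists2 R, R \in unitmx & forall x, sqnorm (x *m A *m R) <= sqnorm (x *m R).
Proof.
elim: n A => [|m IH].
  by exists 1%:M => [|x]; rewrite ?unitmx1 // /sqnorm !big_ord0.
rewrite -[m.+1]/(1 + m)%N => A stA.
have [rs charA] := closed_field_poly_normal (char_poly A).
have eigE a : eigenvalue A a = (a \in rs).
  rewrite eigenvalue_root_char charA (monicP (char_poly_monic A)) scale1r.
  by rewrite root_prod_XsubC.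
have [/hasP[a]|/hasPn no_unimod] := boolP (has (fun a => `|a| == 1) rs); last first.
  have [a /[dup] eA | R [e [uR e_gt0 _ leR]]] := @strict_adapted_norm _ A.
    by rewrite lt_neqAle (stA a eA).1 eigE => /no_unimod ->.
  exists R => // x; apply: (le_trans (leR x)).
  by rewrite ler_piMl ?sqnorm_ge0 // gerBl ltW.
rewrite -eigE => eA /eqP a1.
have ssA := (stA a eA).2 a1.
have [S [c [A' [uS e]]]] := deflate eA.
have {ssA} ssM := semisimple_similar uS e ssA.
have [y cE] : exists y, c = (A' - a%:M) *m y.
  apply: solve_mul_col => x xM; have := ssM (row_mx 0 x).
  rewrite deflated_sub_scalar subrr raddf0 !mul_row_block !mul0mx !mulmx0.
  rewrite !add0r xM !mul0mx row_mx0 => /(_ erefl).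
  by rewrite -[in RHS]row_mx0 => /eq_row_mx[].
(* The shear by [y] clears the lower left block, because [c + a y = A' y]. *)
pose T : 'M_(1 + m) := block_mx 1%:M 0 y 1%:M *m S.
have uT : T \in unitmx.
  by rewrite unitmx_mul uS unitmxE det_lblock !det1 mul1r unitr1.
have eT : T *m A = block_mx a%:M 0 0 A' *m T.
  rewrite /T -mulmxA e !mulmxA; congr (_ *m _); rewrite !mulmx_block.
  rewrite !mul1mx !mulmx1 !mul0mx !mulmx0 !addr0 !add0r cE mulmxBl.
  by rewrite mul_scalar_mx mul_mx_scalar addrC subrK.
have [R' uR' leR'] : exists2 R', R' \in unitmx &
    forall x, sqnorm (x *m A' *m R') <= sqnorm (x *m R').
  (* The rows [(0, x)] span an invariant subspace on which the matrix acts as [A'], so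
     semisimplicity restricts to [A']. *)
  apply: IH => b eb; have [b1 ssb] := stA b (eigenvalue_deflated uT eT eb).
  split=> // /ssb /(semisimple_similar uT eT) ss x xMM.
  have := ss (row_mx 0 x); rewrite deflated_sub_scalar !mul_row_block.
  rewrite !mulmx0 !mul0mx !addr0 !add0r !mul0mx xMM row_mx0 => /(_ erefl).
  by rewrite -[in RHS]row_mx0 => /eq_row_mx[].
exists (invmx T *m block_mx 1%:M 0 0 R').
  by rewrite unitmx_mul unitmx_inv uT (@block_diag_mx_unit _ 1 m) unitmx1.
move=> x; rewrite !mulmxA -[x *m A *m _]mulmxA -(similar_sym uT eT) mulmxA.
rewrite -(hsubmxK (x *m invmx T)).
move: (lsubmx _) (rsubmx _) => x1 x2.
rewrite !mul_row_block !mulmx0 !addr0 !add0r !mulmx1 !sqnorm_row_mx.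
by rewrite mul_mx_scalar sqnormZ a1 expr1n mul1r lerD2l.
Qed.
End AdaptedNorm.

(** * Real matrices *)

Section RealMatrices.
Variable C : numClosedFieldType.
Local Notation realmx := (mxOver Num.real).
Local Notation remx := (map_mx (@Re C)).
Local Notation immx := (map_mx (@Im C)).
Implicit Types m n p : nat.

(** Conjugation is a ring morphism, so closure of real matrices under inverses, blocks and
    differences becomes plain rewriting. *)
Lemma realmx_conjE m n (A : 'M[C]_(m, n)) :
  (A \is a realmx) = (map_mx Num.conj A == A).
Proof.
apply/mxOverP/eqP=> [rA|cA i j]; last by rewrite CrealE -{2}cA mxE.
by apply/matrixP=> i j; rewrite mxE conj_Creal.
Qed.

Lemma realmx_tr m n (A : 'M[C]_(m, n)) : A \is a realmx -> A^T \is a realmx.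
Proof. by move=> /mxOverP rA; apply/mxOverP=> i j; rewrite mxE. Qed.

Lemma realmx_inv n (A : 'M[C]_n) : A \is a realmx -> invmx A \is a realmx.
Proof. by rewrite !realmx_conjE map_invmx => /eqP ->. Qed.

Lemma realmx1 n : (1%:M : 'M[C]_n) \is a realmx.
Proof. by rewrite mxOver_scalar ?rpred0 ?rpred1. Qed.

Lemma realmx_block m n p q (A : 'M[C]_(m, n)) (B : 'M[C]_(m, p))
    (D : 'M[C]_(q, n)) (E : 'M[C]_(q, p)) :
  A \is a realmx -> B \is a realmx -> D \is a realmx -> E \is a realmx ->
  block_mx A B D E \is a realmx.
Proof.
rewrite !realmx_conjE map_block_mx.
by move=> /eqP-> /eqP-> /eqP-> /eqP->.
Qed.

Lemma realmx_row_mx m n p (A : 'M[C]_(m, n)) (B : 'M[C]_(m, p)) :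
  A \is a realmx -> B \is a realmx -> row_mx A B \is a realmx.
Proof. by rewrite !realmx_conjE map_row_mx => /eqP-> /eqP->. Qed.

Lemma realmxB m n (A B : 'M[C]_(m, n)) :
  A \is a realmx -> B \is a realmx -> A - B \is a realmx.
Proof. by rewrite !realmx_conjE map_mxB => /eqP-> /eqP->. Qed.

Lemma remx_real m n (A : 'M[C]_(m, n)) : remx A \is a realmx.
Proof. by apply/mxOverP=> i j; rewrite mxE Creal_Re. Qed.

Lemma immx_real m n (A : 'M[C]_(m, n)) : immx A \is a realmx.
Proof. by apply/mxOverP=> i j; rewrite mxE Creal_Im. Qed.

Lemma remxMr m n p (A : 'M[C]_(m, n)) (B : 'M[C]_(n, p)) :
  B \is a realmx -> remx (A *m B) = remx A *m B.
Proof.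
move=> /mxOverP rB; apply/matrixP=> i j; rewrite !mxE raddf_sum.
by apply: eq_bigr => k _; rewrite mxE /= ReMr.
Qed.

Lemma immxMr m n p (A : 'M[C]_(m, n)) (B : 'M[C]_(n, p)) :
  B \is a realmx -> immx (A *m B) = immx A *m B.
Proof.
move=> /mxOverP rB; apply/matrixP=> i j; rewrite !mxE raddf_sum.
by apply: eq_bigr => k _; rewrite mxE /= ImMr.
Qed.

Lemma remxMl m n p (A : 'M[C]_(m, n)) (B : 'M[C]_(n, p)) :
  A \is a realmx -> remx (A *m B) = A *m remx B.
Proof.
move=> /mxOverP rA; apply/matrixP=> i j; rewrite !mxE raddf_sum.
by apply: eq_bigr => k _; rewrite mxE /= ReMl.
Qed.

Lemma immxMl m n p (A : 'M[C]_(m, n)) (B : 'M[C]_(n, p)) :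
  A \is a realmx -> immx (A *m B) = A *m immx B.
Proof.
move=> /mxOverP rA; apply/matrixP=> i j; rewrite !mxE raddf_sum.
by apply: eq_bigr => k _; rewrite mxE /= ImMl.
Qed.

Lemma sqnorm_ReIm n (x : 'rV[C]_n) : sqnorm x = sqnorm (remx x) + sqnorm (immx x).
Proof.
rewrite /sqnorm -big_split; apply: eq_bigr => j _ /=.
by rewrite !mxE normC2_Re_Im !real_normK ?Creal_Re ?Creal_Im.
Qed.

Lemma sqnorm_real n (x : 'rV[C]_n) : x \is a realmx -> sqnorm x = (x *m x^T) 0 0.
Proof.
move=> /mxOverP rx; rewrite mxE; apply: eq_bigr => j _.
by rewrite mxE real_normK // -expr2.
Qed.

Lemma sqnorm_real_isometry n (x : 'rV[C]_n) (U : 'M[C]_n) :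
  x \is a realmx -> U \is a realmx -> U *m U^T = 1%:M ->
  sqnorm (x *m U) = sqnorm x.
Proof.
move=> rx rU uU; rewrite !sqnorm_real ?mxOverM //.
by rewrite trmx_mul mulmxA -(mulmxA x) uU mulmx1.
Qed.

(** A real matrix acts separately on real and imaginary parts, whose squared norms add up. The
    extension matters because eigenvectors of a real matrix may be complex. *)
Lemma real_contraction n (N : 'M[C]_n) : N \is a realmx ->
  (forall x : 'rV_n, x \is a realmx -> sqnorm (x *m N) <= sqnorm x) ->
  forall x : 'rV_n, sqnorm (x *m N) <= sqnorm x.
Proof.
move=> rN leN x; rewrite sqnorm_ReIm [leRHS]sqnorm_ReIm remxMr // immxMr //.
by rewrite lerD ?leN ?remx_real ?immx_real.
Qed.

(** The real and imaginary parts of a complex kernel vector are kernel vectors too, and one of them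
    is nonzero; it is then normalized. *)
Lemma real_singular_kernel n (M : 'M[C]_n) : M \is a realmx -> M \notin unitmx ->
  exists v : 'rV_n, [/\ v \is a realmx, sqnorm v = 1 & v *m M = 0].
Proof.
move=> rM; rewrite -row_free_unit -kermx_eq0 => /rowV0Pn[w /sub_kermxP wM w0].
have [v [rv v0 vM]] : exists v : 'rV_n, [/\ v \is a realmx, v != 0 & v *m M = 0].
  have [r0|] := eqVneq (remx w) 0; last first.
    by exists (remx w); rewrite remx_real -remxMr // wM map_mx0.
  exists (immx w); rewrite immx_real -immxMr // wM; split=> //; last first.
    by apply/matrixP=> i j; rewrite !mxE raddf0.
  rewrite -sqnorm_eq0; rewrite -sqnorm_eq0 sqnorm_ReIm r0 in w0.
  by rewrite (_ : sqnorm 0 = 0) ?add0r // in w0; apply/eqP; rewrite sqnorm_eq0.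
have v_gt0 : 0 < sqnorm v by rewrite sqnorm_gt0.
pose k := sqrtC (sqnorm v); have k_gt0 : 0 < k by rewrite sqrtC_gt0.
exists (k^-1 *: v); split.
- by rewrite mxOverZ // rpredV gtr0_real.
- by rewrite sqnormZ normfV gtr0_norm // exprVn sqrtCK mulVf // gt_eqF.
- by rewrite -scalemxAl vM scaler0.
Qed.
End RealMatrices.

(** * Real Cholesky and polar factorizations *)

Section Factorizations.
Variable C : numClosedFieldType.
Local Notation realmx := (mxOver Num.real).
Local Notation remx := (map_mx (@Re C)).
Local Notation immx := (map_mx (@Im C)).

Lemma mul11mx n (x : 'M[C]_1) (y : 'rV[C]_n) : x *m y = x 0 0 *: y.
Proof. by rewrite {1}[x]mx11_scalar mul_scalar_mx. Qed.

(** Induction through the Schur complement of the corner entry [p]. *)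
Lemma real_cholesky n (P : 'M[C]_n) : P \is a realmx -> P^T = P ->
  (forall x : 'rV_n, x \is a realmx -> x != 0 -> 0 < (x *m P *m x^T) 0 0) ->
  exists G, [/\ G \is a realmx, G \in unitmx & P = G *m G^T].
Proof.
elim: n P => [|m IH].
  by move=> P _ _ _; exists 1%:M; rewrite realmx1 unitmx1 [P]thinmx0 [RHS]thinmx0.
rewrite -[m.+1]/(1 + m)%N => P rP sP pdP.
pose p := P 0 0; pose b := dlsubmx P; pose D := drsubmx P.
have PE : P = block_mx p%:M b^T b D.
  rewrite -[LHS]submxK; congr block_mx; last by rewrite trmx_dlsub sP.
  by rewrite [LHS]mx11_scalar !mxE /p; congr (P _ _)%:M; apply: val_inj.
have rp : p \is Num.real by exact: (mxOverP rP).
have rb : b \is a realmx by apply/mxOverP=> i j; rewrite !mxE (mxOverP rP).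
have rD : D \is a realmx by apply/mxOverP=> i j; rewrite !mxE (mxOverP rP).
have sD : D^T = D by rewrite trmx_drsub sP.
have p_gt0 : 0 < p.
  have := pdP (row_mx 1%:M 0); rewrite PE mul_row_block tr_row_mx mul_row_col.
  rewrite trmx0 !mulmx0 !mul0mx !mul1mx trmx1 mulmx1 !addr0 mxE mulr1n; apply.
    by rewrite realmx_row_mx ?realmx1 ?mxOver0 ?rpred0.
  rewrite row_mx_eq0; apply/negP=> /andP[/eqP/matrixP/(_ 0 0)/eqP].
  by rewrite !mxE oner_eq0.
have [] := IH (D - p^-1 *: (b *m b^T)).
- by rewrite realmxB // mxOverZ ?rpredV // mxOverM // realmx_tr.
- by rewrite raddfB /= sD linearZ /= trmx_mul trmxK.
(* The first coordinate [- p^-1 x b] minimizes the form over all extensions of [x], and the minimum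
   is the value of the Schur complement at [x]. *)
- move=> x rx x0; have := pdP (row_mx (- p^-1 *: (x *m b)) x).
  rewrite PE mul_row_block tr_row_mx mul_row_col mul_mx_scalar scalerA mulrN.
  rewrite mulfV ?gt_eqF // scaleN1r addNr mul0mx add0r.
  have -> : - p^-1 *: (x *m b) *m b^T + x *m D = x *m (D - p^-1 *: (b *m b^T)).
    by rewrite mulmxBr -scalemxAr mulmxA -scalemxAl scaleNr addrC.
  apply; first by rewrite realmx_row_mx // mxOverZ ?rpredN ?rpredV // mxOverM.
  by apply: contraNneq x0 => /eqP; rewrite row_mx_eq0 => /andP[].
move=> G' [rG' uG' DE]; have DE' : D = G' *m G'^T + p^-1 *: (b *m b^T).
  by rewrite -DE subrK.
pose k := sqrtC p; have k_gt0 : 0 < k by rewrite sqrtC_gt0.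
have rk : k \is Num.real by rewrite gtr0_real.
exists (block_mx k%:M 0 (k^-1 *: b) G'); split.
- by rewrite realmx_block ?mxOver_scalar ?mxOver0 ?rpred0 // mxOverZ ?rpredV.
- by rewrite unitmxE det_lblock det_scalar1 unitrM -unitmxE uG' unitfE gt_eqF.
- rewrite PE tr_block_mx mulmx_block !trmx0 !mulmx0 !mul0mx !addr0 tr_scalar_mx.
  rewrite -scalar_mxM -expr2 sqrtCK linearZ /= -scalemxAr mul_scalar_mx.
  rewrite mul_mx_scalar !scalerA mulVf ?mulfV ?gt_eqF // !scale1r.
  by rewrite -scalemxAl -scalemxAr scalerA -invfM -expr2 sqrtCK addrC -DE'.
Qed.

(** On real [x], |xR|^2 is the quadratic form of the real part [P] of R R^*, positive definite as
    [R] is invertible. Its Cholesky factor [G] thus gives real vectors the same norm as [R]. *)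
Lemma real_adapted_norm n (A R : 'M[C]_n) : A \is a realmx -> R \in unitmx ->
  (forall x : 'rV_n, sqnorm (x *m A *m R) <= sqnorm (x *m R)) ->
  exists G, [/\ G \is a realmx, G \in unitmx
    & forall x : 'rV_n, x \is a realmx -> sqnorm (x *m A *m G) <= sqnorm (x *m G)].
Proof.
move=> rA uR leR.
pose P := remx R *m (remx R)^T + immx R *m (immx R)^T.
have PE (x : 'rV_n) : x \is a realmx -> sqnorm (x *m R) = (x *m P *m x^T) 0 0.
  move=> rx; rewrite sqnorm_ReIm remxMl // immxMl // !sqnorm_real.
  - by rewrite mulmxDr mulmxDl [RHS]mxE !trmx_mul !mulmxA.
  - by rewrite mxOverM ?immx_real.
  - by rewrite mxOverM ?remx_real.
have [||x rx x0|G [rG uG PG]] := @real_cholesky n P.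
- by rewrite realmxD // mxOverM ?realmx_tr ?remx_real ?immx_real.
- by rewrite raddfD /= !trmx_mul !trmxK.
- rewrite -PE // sqnorm_gt0; apply: contraNneq x0 => xR0.
  by rewrite -(mulmxK uR x) xR0 mul0mx.
exists G; split=> // x rx.
have GE (y : 'rV_n) : y \is a realmx -> sqnorm (y *m G) = sqnorm (y *m R).
  move=> ry; rewrite PE // sqnorm_real ?mxOverM //.
  by rewrite PG trmx_mul !mulmxA.
by rewrite !GE ?mxOverM.
Qed.

(* Householder reflection exchanging [v] and the first basis vector *)
Lemma real_orthogonal_completion m (v : 'rV[C]_(1 + m)) :
  v \is a realmx -> sqnorm v = 1 ->
  exists Q : 'M_(1 + m), [/\ Q \is a realmx, Q *m Q^T = 1%:M & usubmx Q = v].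
Proof.
move=> rv v1; pose e1 : 'rV[C]_(1 + m) := row_mx 1%:M 0.
have usubE (Q : 'M[C]_(1 + m)) : usubmx Q = e1 *m Q.
  by rewrite -{2}[Q]vsubmxK mul_row_col mul1mx mul0mx addr0.
have re1 : e1 \is a realmx.
  by rewrite realmx_row_mx ?realmx1 ?mxOver0 ?rpred0.
have e1e1 : e1 *m e1^T = 1%:M.
  by rewrite tr_row_mx mul_row_col trmx1 trmx0 mulmx0 addr0 mulmx1.
have vv : v *m v^T = 1%:M.
  by rewrite [LHS]mx11_scalar -sqnorm_real // v1.
(* The reflection along [v - e1] degenerates when [v = e1], where the identity serves. *)
have [ve|ve] := eqVneq v e1.
  by exists 1%:M; rewrite realmx1 trmx1 mulmx1 usubE mulmx1.
pose w := v - e1.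
have rw : w \is a realmx by rewrite realmxB.
have w_gt0 : 0 < sqnorm w by rewrite sqnorm_gt0 subr_eq0.
have ww : w *m w^T = (sqnorm w)%:M by rewrite [LHS]mx11_scalar -sqnorm_real.
pose k := 2 / sqnorm w.
pose Q := 1%:M - k *: (w^T *m w).
have sQ : Q^T = Q by rewrite /Q raddfB /= trmx1 linearZ /= trmx_mul trmxK.
exists Q; split.
- rewrite realmxB ?realmx1 // mxOverZ ?mxOverM ?realmx_tr //.
  by rewrite gtr0_real // divr_gt0.
- have ww2 : w^T *m w *m (w^T *m w) = sqnorm w *: (w^T *m w).
    by rewrite mulmxA -(mulmxA w^T w) ww mul_mx_scalar scalemxAl.
  rewrite sQ /Q mulmxBr mulmx1 mulmxBl mul1mx -scalemxAr -scalemxAl ww2 !scalerA.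
  have -> : k * k * sqnorm w = k + k by rewrite /k; field; rewrite gt_eqF.
  by rewrite scalerDl opprB addrK subrK.
- rewrite usubE /Q mulmxBr mulmx1 -scalemxAr mulmxA mul11mx scalerA.
  pose d := (e1 *m v^T) 0 0.
  have subE (X Y : 'M[C]_1) : (X - Y) 0 0 = X 0 0 - Y 0 0 by rewrite !mxE.
  have oneE : (1%:M : 'M[C]_1) 0 0 = 1 by rewrite mxE.
  have e1w : (e1 *m w^T) 0 0 = d - 1.
    by rewrite /w raddfB /= mulmxBr e1e1 subE oneE.
  (* As [v] and [e1] are unit vectors, |w|^2 = 2 (1 - d); hence [k * (d - 1) = -1] and
     [e1 Q = e1 + w = v]. *)
  have wE : sqnorm w = 2 * (1 - d).
    have ve1 : (v *m e1^T) 0 0 = d.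
      by rewrite -[v *m _]trmxK [LHS]mxE trmx_mul trmxK.
    rewrite sqnorm_real // {1}/w mulmxBl subE e1w /w raddfB /= mulmxBr vv subE.
    by rewrite oneE ve1; ring.
  have d0 : 1 - d != 0.
    by apply: contraTneq w_gt0 => d0; rewrite wE d0 mulr0 ltxx.
  have -> : k * (e1 *m w^T) 0 0 = -1 by rewrite e1w /k wE; field.
  by rewrite scaleN1r opprK addrC subrK.
Qed.

(** For invertible [N], [p] is a unit eigenvector of N N^T for [l], with [s] the root of [l] and
    [u = p N / s]. For singular [N], [s = 0] and unit kernel vectors of [N] and of its transpose
    serve. *)
Lemma real_singular_pair m (N : 'M[C]_(1 + m)) : N \is a realmx ->
  exists s p u, [/\ 0 <= s, p \is a realmx /\ u \is a realmx,
    sqnorm p = 1 /\ sqnorm u = 1, p *m N = s *: u & u *m N^T = s *: p].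
Proof.
move=> rN; have rNT := realmx_tr rN.
have [uN|sN] := boolP (N \in unitmx); last first.
  have [p [rp p1 pN]] := real_singular_kernel rN sN.
  have [|u [ru u1 uN]] := real_singular_kernel rNT; first by rewrite unitmx_tr.
  by exists 0, p, u; rewrite !scale0r.
have [l el] := eigenvalue_closed (N *m N^T) (ltn0Sn m).
have l_ge0 : 0 <= l.
  have /eigenvalueP[v vl v0] := el.
  have : l * sqnorm v = sqnorm (v *m N).
    have dotE n (x : 'rV[C]_n) : sqnorm x = (x *m (map_mx Num.conj x)^T) 0 0.
      by rewrite -dot_self mxE; apply: eq_bigr => j _; rewrite !mxE.
    have cN : map_mx Num.conj N = N by apply/eqP; rewrite -realmx_conjE.
    rewrite !dotE map_mxM cN trmx_mul !mulmxA -(mulmxA v N) vl.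
    by rewrite -scalemxAl [RHS]mxE.
  move=> lE; rewrite -(pmulr_lge0 _ (_ : 0 < sqnorm v)) ?sqnorm_gt0 //.
  by rewrite lE sqnorm_ge0.
have rl : l \is Num.real by rewrite ger0_real.
(* Now that [l] is known to be real, N N^T - l is a real singular matrix, so the eigenvector can be
   taken real. *)
have [||p [rp p1]] := @real_singular_kernel _ _ (N *m N^T - l%:M).
- by rewrite realmxB ?mxOverM // mxOver_scalar // rpred0.
- by rewrite -row_free_unit -kermx_eq0.
move=> /eqP; rewrite mulmxBr subr_eq0 mul_mx_scalar => /eqP pl.
have l_gt0 : 0 < l.
  rewrite lt_def l_ge0 andbT; apply: contraTneq (oner_neq0 C) => l0.
  rewrite negbK -p1 sqnorm_eq0 -(mulmxK (_ : N *m N^T \in unitmx) p).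
    by rewrite pl l0 scale0r mul0mx.
  by rewrite unitmx_mul unitmx_tr uN.
pose s := sqrtC l; have s_gt0 : 0 < s by rewrite sqrtC_gt0.
have rs : s \is Num.real by rewrite gtr0_real.
have ru : s^-1 *: (p *m N) \is a realmx by rewrite mxOverZ ?rpredV ?mxOverM.
exists s, p, (s^-1 *: (p *m N)); split; rewrite ?(ltW s_gt0) //.
- split=> //; rewrite sqnormZ sqnorm_real ?mxOverM // trmx_mul mulmxA -(mulmxA p) pl.
  rewrite -scalemxAl mxE -sqnorm_real // p1 mulr1 normfV gtr0_norm //.
  by rewrite exprVn sqrtCK mulVf // gt_eqF.
- by rewrite scalerA mulfV ?gt_eqF // scale1r.
- by rewrite -scalemxAl -mulmxA pl scalerA -[l]sqrtCK -/s expr2 mulKf // gt_eqF.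
Qed.

(** Orthogonal [P] and [Q] whose first rows form a singular pair bring [N] to block diagonal form
    with corner [s]; the remaining block is factored by induction. *)
Theorem real_polar n (N : 'M[C]_n) : N \is a realmx ->
  exists U B, [/\ U \is a realmx, B \is a realmx, U^T *m U = 1%:M & B^T = B] /\
    (forall x : 'rV_n, x \is a realmx -> 0 <= (x *m B *m x^T) 0 0) /\ N = U *m B.
Proof.
elim: n N => [|m IH].
  move=> N _; exists 1%:M, 0; rewrite realmx1 mxOver0 ?rpred0 // !trmx1 mulmx1 trmx0.
  split=> //; split=> [x _|]; last by rewrite [LHS]thinmx0 mulmx0.
  by rewrite mulmx0 mul0mx mxE.
rewrite -[m.+1]/(1 + m)%N => N rN.
have [s [p [u [s_ge0 [rp ru] [p1 u1] pN uN]]]] := real_singular_pair rN.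
have [P [rP PP Pp]] := real_orthogonal_completion rp p1.
have [Q [rQ QQ Qu]] := real_orthogonal_completion ru u1.
have P'P := mulmx1C PP; have Q'Q := mulmx1C QQ.
pose M := P *m N *m Q^T.
have rM : M \is a realmx by rewrite !mxOverM ?realmx_tr.
(* The first row uses [p N = s u]; the first column, below, uses u N^T = s p. *)
have uM : usubmx M = row_mx s%:M 0.
  rewrite /M -!mul_usub_mx Pp pN -Qu -scalemxAl mul_usub_mx QQ.
  exact: scale_usubmx1.
have uMT : usubmx M^T = row_mx s%:M 0.
  rewrite /M !trmx_mul trmxK mulmxA -!mul_usub_mx Qu uN -Pp -scalemxAl mul_usub_mx PP.
  exact: scale_usubmx1.
have ME : M = block_mx s%:M 0 0 (drsubmx M).
  rewrite -[LHS]submxK; congr block_mx.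
  - by rewrite /ulsubmx uM row_mxKl.
  - by rewrite /ursubmx uM row_mxKr.
  - by apply: trmx_inj; rewrite trmx_dlsub trmx0 /ursubmx uMT row_mxKr.
have [|U [B [[rU rB uU sB] [psdB dE]]]] := IH (drsubmx M).
  by apply/mxOverP=> i j; rewrite mxE [dsubmx _ _ _]mxE (mxOverP rM).
have rs : s \is Num.real by rewrite ger0_real.
(* The inner Q Q^T cancels in the product, leaving P^T M Q = N; the corner [s >= 0] goes into the
   semidefinite factor. *)
exists (P^T *m block_mx 1%:M 0 0 U *m Q), (Q^T *m block_mx s%:M 0 0 B *m Q).
split; [split | split].
- by rewrite !mxOverM ?realmx_tr // realmx_block ?realmx1 ?mxOver0 ?rpred0.
- by rewrite !mxOverM ?realmx_tr // realmx_block ?mxOver0 ?mxOver_scalar ?rpred0.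
- rewrite !trmx_mul trmxK !mulmxA -[_ *m P *m P^T]mulmxA PP mulmx1.
  rewrite -[_ *m _ *m block_mx _ _ _ _]mulmxA tr_block_mx mulmx_block.
  rewrite !trmx0 trmx1 !mulmx0 !mul0mx !addr0 add0r mulmx1 uU.
  by rewrite -scalar_mx_block mulmx1 Q'Q.
- by rewrite !trmx_mul trmxK tr_block_mx !trmx0 tr_scalar_mx sB mulmxA.
- move=> x rx; rewrite !mulmxA -[_ *m Q *m x^T]mulmxA.
  have -> : Q *m x^T = (x *m Q^T)^T by rewrite trmx_mul trmxK.
  have : x *m Q^T \is a realmx by rewrite mxOverM // realmx_tr.
  rewrite -(hsubmxK (x *m Q^T)); move: (lsubmx _) (rsubmx _) => x1 x2 rx12.
  have rx1 : x1 \is a realmx.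
    by apply/mxOverP=> i j; rewrite -(row_mxEl x1 x2) (mxOverP rx12).
  have rx2 : x2 \is a realmx.
    by apply/mxOverP=> i j; rewrite -(row_mxEr x1 x2) (mxOverP rx12).
  rewrite mul_row_block !mulmx0 addr0 add0r tr_row_mx mul_row_col mul_mx_scalar.
  rewrite -scalemxAl [leRHS]mxE addr_ge0 ?psdB // [leRHS]mxE mulr_ge0 //.
  by rewrite -sqnorm_real // sqnorm_ge0.
- rewrite !mulmxA -[_ *m Q *m Q^T]mulmxA QQ mulmx1 -[_ *m _ *m block_mx _ _ _ _]mulmxA.
  rewrite mulmx_block !mulmx0 !mul0mx !addr0 !add0r mul1mx -dE -ME /M.
  by rewrite !mulmxA P'P mul1mx -mulmxA Q'Q mulmx1.
Qed.
End Factorizations.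

(** Symmetry makes [B x] the transpose of x^T B, so the column condition turns into the row
    convention of the adapted norms. *)
Lemma spec_norm_le1_row (C : numClosedFieldType) n (B : 'M[C]_n) :
  B \is a mxOver Num.real -> B^T = B ->
  spec_norm_le1 B <-> forall x : 'rV_n, x \is a mxOver Num.real ->
    sqnorm (x *m B) <= sqnorm x.
Proof.
move=> rB sB; have rowE (x : 'cV_n) : x \is a mxOver Num.real ->
    ((B *m x)^T *m (B *m x)) 0 0 = sqnorm (x^T *m B) /\ (x^T *m x) 0 0 = sqnorm x^T.
  move=> rx; have rxT := realmx_tr rx.
  by rewrite !sqnorm_real ?mxOverM // !trmx_mul trmxK sB.
split=> leB x rx; last first.
  have rx' : x \is a mxOver Num.real by apply/mxOverP.
  by have [-> ->] := rowE x rx'; apply/leB/realmx_tr.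
have rxT := realmx_tr rx; have [xBE xE] := rowE _ rxT.
by move: (leB x^T (mxOverP rxT)); rewrite xBE xE trmxK.
Qed.

Theorem theorem2 (C : numClosedFieldType) (n : nat) (A : 'M[C]_n) :
  real_mx A ->
  (stable A <->
   exists S U B : 'M[C]_n,
     (real_mx S /\ real_mx U /\ real_mx B) /\
     S \in unitmx /\ U^T *m U = 1%:M /\
     sym_psd B /\ spec_norm_le1 B /\
     A = invmx S *m U *m B *m S).
Proof.
move=> /mxOverP rA; split=> [stA | [S [U [B]]]].
  have [a ea|R uR leR] := @adapted_norm _ _ A.
    have [a1 ssa] := stA a ea.
    by split=> // /ssa; apply: (semisimple_atP A a).1.
  have [G [rG uG leG]] := real_adapted_norm rA uR leR.
  have riG := realmx_inv rG.
  pose N := invmx G *m A *m G.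
  have rN : N \is a mxOver Num.real by rewrite !mxOverM.
  have leN x : x \is a mxOver Num.real -> sqnorm (x *m N) <= sqnorm x.
    move=> rx; have := leG (x *m invmx G).
    by rewrite /N !mulmxA mulmxKV //; apply; rewrite mxOverM.
  have [U [B [[rU rB uU sB] [psdB NE]]]] := real_polar rN.
  exists (invmx G), U, B; split; first by split; [|split]; apply/mxOverP.
  split; first by rewrite unitmx_inv.
  split=> //; split; first split=> // x /mxOverP rx.
    by have := psdB x^T; rewrite trmxK; apply; apply: realmx_tr.
  split.
    apply/spec_norm_le1_row => // x rx; have rUT := realmx_tr rU.
    (* The factor U^T is an isometry, so [B] inherits the contraction property of [N]. *)
    have -> : B = U^T *m N by rewrite NE mulmxA uU mul1mx.
    rewrite mulmxA (le_trans (leN _ _)) ?mxOverM //.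
    by rewrite sqnorm_real_isometry // trmxK.
  by rewrite invmxK -(mulmxA G U) -NE /N !mulmxA mulmxV // mul1mx mulmxK.
case=> -[/mxOverP rS [/mxOverP rU /mxOverP rB]] [uS [uU [[sB _] [leB AE]]]].
pose N := U *m B.
have e : S *m A = N *m S by rewrite AE !mulmxA mulmxV // mul1mx.
(* For real [x], |x U B| <= |x U| = |x|; complex vectors follow because [N] is real. *)
have leN : forall x, sqnorm (x *m N) <= sqnorm x.
  apply: real_contraction => [|x rx]; first by rewrite mxOverM.
  rewrite mulmxA -[leRHS](sqnorm_real_isometry rx rU (mulmx1C uU)).
  by apply: (spec_norm_le1_row rB sB).1; rewrite // mxOverM.
move=> a; rewrite eigenvalue_root_char (char_poly_similar uS e).
rewrite -eigenvalue_root_char => /(contraction_eigenvalue_le1 leN) a1; split=> // a1'.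
apply/semisimple_atP/(@semisimple_similar _ _ (invmx S) N).
- by rewrite unitmx_inv.
- exact: similar_sym.
- exact: contraction_semisimple.
Qed.
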